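(* Let $(F_1,\|\cdot\|_1)$ be a normed space of integrable univariate functions over a Borel set $D_1\subseteq\mathbb{R}$ and, for $d\in\mathbb{N}$, let $(F_d,\|\cdot\|_d)$ be the $d$-fold tensor product space equipped with a crossnorm $\|\cdot\|_d$. Assume that in $F_1$ there exists a worst-case function $h_1$ (with $h_d(x_1,\dots,x_d)=\prod_{j=1}^d h_1(x_j)$ a worst-case function in $F_d$ for every $d$) which can be decomposed as $h_1=h_{1,(0)}+h_{1,(1)}$ on $D_1$ such that: (D1) $h_{1,(0)},h_{1,(1)}\in F_1$; (D2) there is $a\in\mathbb{R}$ such that $D_{(0)}:=\{x\in D_1: x\le a\}$ and $D_{(1)}:=\{x\in D_1: x\ge a\}$ are non-empty, the support of $h_{1,(0)}$ is contained in $D_{(0)}$, and the support of $h_{1,(1)}$ is contained in $D_{(1)}$; (D3) the integrals $I_1(h_{1,(0)})$ and $I_1(h_{1,(1)})$ are positive; (D4) for every $d\in\mathbb{N}$ and every family $\mathcal{D}$ of subsets of $[d]$, $$\Big\|\sum_{\mathfrak{u}\in\mathcal{D}}\prod_{j\in\mathfrak{u}}h_{1,(0)}(x_j)\prod_{j\in[d]\setminus\mathfrak{u}}h_{1,(1)}(x_j)\Big\|_d\le\Big\|\sum_{\mathfrak{u}\subseteq[d]}\prod_{j\in\mathfrak{u}}h_{1,(0)}(x_j)\prod_{j\in[d]\setminus\mathfrak{u}}h_{1,(1)}(x_j)\Big\|_d .$$ Then the $N$-th minimal integration error in $F_d$ satisfies $$e(N,d)\ge(1-N\alpha^d)_+\,e(0,d),\qquad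 \alpha:=\frac{\max(I_1(h_{1,(0)}),I_1(h_{1,(1)}))}{I_1(h_{1,(0)})+I_1(h_{1,(1)})}\in\left[\tfrac12,1\right).$$ Furthermore, the information complexity satisfies $$N(\varepsilon,d)\ge\left(\frac1\alpha\right)^d(1-\varepsilon)\quad\text{for all }\varepsilon\in(0,1)\text{ and }d\in\mathbb{N}.$$ In particular, the integration problem over $F_d$ suffers from the curse of dimensionality.
   Context: Notation: $\mathbb{N}=\{1,2,\dots\}$, $[d]=\{1,\dots,d\}$, $(x)_+=\max(x,0)$; empty products are $1$. Setting: $D_d=D_1\times\dots\times D_1$ ($d$-fold). $F_d=F_1\otimes\dots\otimes F_1$ ($d$-fold) is a tensor product space of functions on $D_d$, with a norm $\|\cdot\|_d$ that is a crossnorm, i.e. $\|f\|_d=\|f_1\|_1\cdots\|f_d\|_1$ for elementary tensors $f(x_1,\dots,x_d)=f_1(x_1)\cdots f_d(x_d)$. $F_d$ is not claimed to be uniquely determined by these requirements. Integration: $I_d(f)=\int_{D_d}f(\boldsymbol{x})\,\mathrm{d}\boldsymbol{x}$. Initial error: $e(0,d)=\sup\{|I_d(f)|: f\in F_d,\ \|f\|_d\le1\}$. A linear algorithm is $A_{d,N}(f)=\sum_{k=1}^N a_kf(\boldsymbol{x}_k)$ with nodes $\boldsymbol{x}_k\in D_d$ and weights $a_k\in\mathbb{R}$; its worst-case error is $e(F_d,A_{d,N})=\sup\{|I_d(f)-A_{d,N}(f)|: f\in F_d,\ \|f\|_d\le1\}$. The $N$-th minimal error $e(N,d)$ is the minimum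 of $e(F_d,A_{d,N})$ over all linear algorithms using $N$ nodes. Information complexity: $N(\varepsilon,d)=\min\{N\in\mathbb{N}: e(N,d)\le\varepsilon\,e(0,d)\}$. Curse of dimensionality: for some fixed $\varepsilon>0$, $N(\varepsilon,d)$ grows at least exponentially fast in $d$. Worst-case function: $h_1\in F_1$ with $e(0,1)=I_1(h_1/\|h_1\|_1)$. Standing assumption: for every $d$ the tensor product $h_d(\boldsymbol{x})=\prod_{j=1}^dh_1(x_j)$ is a worst-case function in $F_d$, i.e. $e(0,d)=I_d(h_d/\|h_d\|_d)$, hence $e(0,d)=e(0,1)^d$.
   Formalization: It is additionally assumed that h_{1,(0)}(a)=0 or h_{1,(1)}(a)=0; without this the claim fails, e.g. for h_{1,(0)}=1_{[-1,0]}, h_{1,(1)}=1_{[0,1]}, F_d their tensor span with the max-coefficient norm, where f(0,...,0)=I_d(f), so e(1,d)=0. *)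

(* Defs.v *)
From HB Require Import structures.
From mathcomp Require Import all_boot all_order all_algebra.
From mathcomp Require Import all_classical all_reals all_analysis.

Set Implicit Arguments.
Unset Strict Implicit.
Unset Printing Implicit Defensive.

Import Order.TTheory GRing.Theory Num.Theory.
Import numFieldNormedType.Exports.

Local Open Scope classical_set_scope.
Local Open Scope ring_scope.

(* Lebesgue measure on R^n = n.-tuple R (with the product sigma-algebra, i.e.
   the Borel sets), obtained by transporting the product of the Lebesgue
   measures on R and R^(n-1) along (x, (x_2, ..., x_n)) |-> (x, x_2, ..., x_n);
   on the one-point space R^0 it is the unit mass. *)
Section cons_measure.
Context d (T : measurableType d) (R : realType) (n : nat).
Variable m1 : {sigma_finite_measure set T -> \bar R}.
Variable m2 : {sigma_finite_measure set (n.-tuple T) -> \bar R}.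

Definition tcons (p : T * n.-tuple T) : n.+1.-tuple T :=
  [the n.+1.-tuple T of p.1 :: p.2].

Lemma measurable_tcons : measurable_fun [set: T * n.-tuple T] tcons.
Proof. exact: (measurable_cons measurable_fst measurable_snd). Qed.

Definition cons_measure : set (n.+1.-tuple T) -> \bar R :=
  pushforward (m1 \x m2)%E tcons.

Let cons_measure0 : cons_measure set0 = 0%E.
Proof. by rewrite /cons_measure /pushforward preimage_set0 measure0. Qed.

Let cons_measure_ge0 A : (0 <= cons_measure A)%E.
Proof. by rewrite /cons_measure /pushforward; exact: measure_ge0. Qed.

Let cons_measure_sigma_additive : semi_sigma_additive cons_measure.
Proof.
move=> F mF tF mUF; rewrite /cons_measure /pushforward preimage_bigcup.
apply: measure_semi_sigma_additive.
- by move=> k; rewrite -[X in measurable X]setTI; exact: measurable_tcons.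
- apply/trivIsetP => /= i j _ _ ij; rewrite -preimage_setI.
  by move/trivIsetP : tF => /(_ _ _ _ _ ij) ->//; rewrite preimage_set0.
- by rewrite -preimage_bigcup -[X in measurable X]setTI; exact: measurable_tcons.
Qed.

HB.instance Definition _ := isMeasure.Build _ _ _ cons_measure
  cons_measure0 cons_measure_ge0 cons_measure_sigma_additive.

Let cons_measure_sigma_finite : sigma_finite setT cons_measure.
Proof.
have /sigma_finiteP[F [TF ndF Foo]] := sigma_finiteT m1.
have /sigma_finiteP[G [TG ndG Goo]] := sigma_finiteT m2.
pose g (t : n.+1.-tuple T) : T * n.-tuple T := (thead t, [tuple of behead t]).
have mg : measurable_fun setT g.
  by apply: measurable_fun_pair; [exact: measurable_tnth|exact: measurable_behead].
have gK p : g (tcons p) = p by case: p => x t; congr pair; exact: val_inj.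
exists (fun k => g @^-1` (F k `*` G k)).
  apply/esym; rewrite -subTset => t _.
  have : setT (g t).1 by []. rewrite TF => -[i _ Fi].
  have : setT (g t).2 by []. rewrite TG => -[j _ Gj].
  exists (maxn i j) => //; split.
    by move: Fi; apply/subsetPset/ndF/leq_maxl.
  by move: Gj; apply/subsetPset/ndG/leq_maxr.
move=> k; have [mF Fk] := Foo k; have [mG Gk] := Goo k; split.
  by rewrite -[X in measurable X]setTI; apply: mg => //; exact: measurableX.
rewrite /cons_measure /pushforward -comp_preimage.
rewrite (_ : g \o tcons = id); last by apply/funext => p; exact: gK.
by rewrite preimage_id product_measure1E// lte_mul_pinfty// ge0_fin_numE.
Qed.

HB.instance Definition _ := Measure_isSigmaFinite.Build _ _ _ cons_measure
  cons_measure_sigma_finite.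

End cons_measure.

Fixpoint lebesgue_tuple (R : realType) (n : nat) :
    {sigma_finite_measure set (n.-tuple (measurableTypeR R)) -> \bar R} :=
  match n with
  | 0%N => (\d_([tuple] : 0.-tuple (measurableTypeR R)))%R
  | m.+1 => cons_measure (@lebesgue_measure R) (lebesgue_tuple R m)
  end.

Lemma measurable_tuple_box (R : realType) n
    (A : 'I_n -> set (measurableTypeR R)) :
  (forall j, measurable (A j)) ->
  measurable [set x : n.-tuple (measurableTypeR R) | forall j, A j (tnth x j)].
Proof.
move=> mA.
rewrite (_ : mkset _ = \big[setI/setT]_(j < n) (fun x => tnth x j) @^-1` A j).
  apply: bigsetI_measurable => j _; rewrite -[X in measurable X]setTI.
  exact: measurable_tnth.
rewrite -bigcap_seq; apply/seteqP; split => [x H j _|x H j]; first exact: H.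
by apply: H; rewrite /= mem_index_enum.
Qed.

Lemma lebesgue_tuple_box (R : realType) n
    (A : 'I_n -> set (measurableTypeR R)) : (forall j, measurable (A j)) ->
  lebesgue_tuple R n [set x | forall j, A j (tnth x j)]
  = (\prod_(j < n) lebesgue_measure (A j))%E.
Proof.
elim: n A => [|n IH] A mA /=.
  by rewrite big_ord0 diracE mem_set//; case.
rewrite /cons_measure /pushforward big_ord_recl.
rewrite -(IH (fun j => A (lift ord0 j)))// -product_measure1E//.
- have tE (x : measurableTypeR R) (t : n.-tuple (measurableTypeR R)) (j : 'I_n) : tnth (tcons (x, t)) (lift ord0 j) = tnth t j by rewrite !(tnth_nth x).
  congr (_ _); apply/seteqP; split=> -[x t] /= H.
    split; first exact: (H ord0).
    by move=> j /=; rewrite -(tE x); exact: H.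
  case: H => Hx Ht j; case: (unliftP ord0 j) => [i ->|->]//.
  by rewrite tE; exact: Ht.
- exact: (@measurable_tuple_box _ _ (fun j => A (lift ord0 j))).
Qed.

(* A normed space of integrable functions on D: the elements of [fs_space] are
   identified with functions by the injective linear map [fs_eval].  A function
   on D is represented by its extension by 0 to the ambient space T. *)
Record fun_space d (T : measurableType d) (R : realType)
    (mu : {measure set T -> \bar R}) (D : set T) := FunSpace {
  fs_space :> normedModType R ;
  fs_eval : fs_space -> T -> R ;
  fs_eval_linear : forall (a : R) (f g : fs_space) (x : T),
    fs_eval (a *: f + g) x = a * fs_eval f x + fs_eval g x ;
  fs_eval_inj : injective fs_eval ;
  fs_eval_out : forall (f : fs_space) (x : T), ~ D x -> fs_eval f x = 0 ;
  fs_integrable : forall f : fs_space, mu.-integrable D (EFin \o fs_eval f)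
}.

Section integration.
Context d (T : measurableType d) (R : realType).
Context (mu : {measure set T -> \bar R}) (D : set T) (F : fun_space mu D).

Definition Int (f : F) : R := \int[mu]_(x in D) fs_eval f x.

Definition unit_ball : set F := [set f | `|f| <= 1].

Definition init_error : \bar R := ereal_sup [set `|Int f|%:E | f in unit_ball].

Definition lin_alg (N : nat) (a : 'I_N -> R) (x : 'I_N -> T) (f : F) : R :=
  \sum_(k < N) a k * fs_eval f (x k).

(* Worst-case errors are extended reals, since the error of an algorithm need
   not be bounded on the unit ball. *)
Definition wc_error (A : F -> R) : \bar R :=
  ereal_sup [set `|Int f - A f|%:E | f in unit_ball].

Definition min_error (N : nat) : \bar R :=
  ereal_inf [set e | exists (a : 'I_N -> R) (x : 'I_N -> T),
    (forall k, D (x k)) /\ e = wc_error (lin_alg a x)].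

(* The minimum over the positive integers N; it is +oo if no N qualifies. *)
Definition info_complexity (eps : R) : \bar R :=
  ereal_inf [set N%:R%:E | N in
    [set N : nat | (0 < N)%N /\ (min_error N <= eps%:E * init_error)%E]].

Definition worst_case (h : F) : Prop := init_error = (Int (`|h|^-1 *: h))%:E.

End integration.

Section tensor.
Context (R : realType) (D1 : set (measurableTypeR R)).

Definition box (d : nat) : set (d.-tuple (measurableTypeR R)) :=
  [set x | forall j : 'I_d, D1 (tnth x j)].

(* A d-fold tensor power of F1 with a crossnorm: a normed function space on D_d
   that contains the elementary tensors and in which their linear span (the
   algebraic tensor product) is dense.  Both the algebraic tensor product and
   its completions (partial or not) are allowed.  The 1-fold power is F1. *)
Record tensor_power (F1 : fun_space (@lebesgue_measure R) D1) (d : nat) :=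
  TensorPower {
  tp_space :> fun_space (lebesgue_tuple R d) (@box d) ;
  elem : ('I_d -> F1) -> tp_space ;
  elemE : forall (f : 'I_d -> F1) (x : d.-tuple (measurableTypeR R)),
    fs_eval (elem f) x = \prod_(j < d) fs_eval (f j) (tnth x j) ;
  elem_crossnorm : forall f : 'I_d -> F1, `|elem f| = \prod_(j < d) `|f j| ;
  elem_dense : closure [set g : tp_space |
    exists s : seq (R * ('I_d -> F1)), g = \sum_(p <- s) p.1 *: elem p.2]
    = setT ;
  elem_one : d = 1%N ->
    forall g : tp_space, exists f : F1, g = elem (fun=> f)
}.

(* prod_(j in u) h0(x_j) * prod_(j notin u) h1(x_j).  Pitfall: if h0 and h1 are
   supported in {x <= a} and {x >= a}, distinct u give products with disjoint
   supports only when h0 a = 0 or h1 a = 0; otherwise all the products are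
   nonzero at the node (a, ..., a). *)
Definition mixed (F1 : fun_space (@lebesgue_measure R) D1) (d : nat)
    (F : tensor_power F1 d) (h0 h1 : F1) (u : {set 'I_d}) : F :=
  elem F (fun j => if j \in u then h0 else h1).

(* The information complexity grows at least exponentially in the dimension,
   for some fixed error threshold. *)
Definition curse (F1 : fun_space (@lebesgue_measure R) D1)
    (F : forall d, tensor_power F1 d) : Prop :=
  exists eps : R, 0 < eps /\ exists c gamma : R, 0 < c /\ 1 < gamma /\
    forall d : nat, (0 < d)%N ->
      ((c * gamma ^+ d)%:E <= info_complexity (F d) eps)%E.

End tensor.

(* Main.v *)
(* Expanding h_d = prod_j (h0 + h1)(x_j) gives a sum of 2^d products indexed by
   u in 2^[d].  Since h0 and h1 have disjoint supports, each node x_k meets the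
   support of at most one of these products, so after discarding at most N of
   them the remaining sum f vanishes at all the nodes, and (D4) still bounds its
   norm by that of h_d.  An algorithm cannot tell f from 0, hence errs on
   f / |h_d| by at least I_d(f) / |h_d|.  By Fubini each discarded product has
   integral at most max(I_1(h0), I_1(h1))^d = alpha^d I_d(h_d). *)
Require Import Defs.
From mathcomp Require Import all_boot all_order all_algebra.
From mathcomp Require Import all_classical all_reals all_analysis.
From mathcomp Require Import measurable_realfun.
Import Order.TTheory GRing.Theory Num.Theory.
Import numFieldNormedType.Exports.
Local Open Scope classical_set_scope.
Local Open Scope ring_scope.

(** * Fubini's theorem for products of one-variable functions *)

(** By Tonelli: the inner integral of the absolute value is [|f x|] times the finite norm of [g] in
    L1, so the iterated integral is a product of two finite norms. *)
Lemma integrable_tensor {d1 d2} {T1 : measurableType d1}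
    {T2 : measurableType d2} {R : realType}
    {m1 : {sigma_finite_measure set T1 -> \bar R}}
    {m2 : {sigma_finite_measure set T2 -> \bar R}}
    {f : T1 -> R} {g : T2 -> R} :
  m1.-integrable setT (EFin \o f) -> m2.-integrable setT (EFin \o g) ->
  (m1 \x m2)%E.-integrable setT (fun p => (f p.1 * g p.2)%:E).
Proof.
move=> intf intg.
have mf : measurable_fun setT f by apply/measurable_EFinP/(measurable_int m1).
have mg : measurable_fun setT g by apply/measurable_EFinP/(measurable_int m2).
apply/integrable12ltyP.
  by apply/measurable_EFinP/measurable_funM; apply: measurableT_comp.
have normE x : (\int[m2]_y `|(f x * g y)%:E| =
    `|(f x)%:E| * \int[m2]_y `|(g y)%:E|)%E.
  rewrite -ge0_integralZl//.
  - by apply: eq_integral => y _; rewrite EFinM abseM.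
  - by apply: measurableT_comp => //; apply/measurable_EFinP.
under eq_integral do rewrite normE.
have /integrableP[_ foo] := intf; have /integrableP[_ goo] := intg.
rewrite ge0_integralZr//.
- by rewrite lte_mul_pinfty ?integral_ge0// ge0_fin_numE ?integral_ge0.
- by apply: measurableT_comp => //; apply/measurable_EFinP.
- exact: integral_ge0.
Qed.

Lemma integral_tensor {d1 d2} {T1 : measurableType d1}
    {T2 : measurableType d2} {R : realType}
    {m1 : {sigma_finite_measure set T1 -> \bar R}}
    {m2 : {sigma_finite_measure set T2 -> \bar R}}
    {f : T1 -> R} {g : T2 -> R} :
  m1.-integrable setT (EFin \o f) -> m2.-integrable setT (EFin \o g) ->
  (\int[(m1 \x m2)%E]_p (f p.1 * g p.2) =
   (\int[m1]_x f x) * (\int[m2]_y g y))%R.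
Proof.
move=> intf intg; rewrite {1}/Rintegral -integral12_prod_meas1; last first.
  exact: integrable_tensor.
rewrite -fineM ?integrable_fin_num//; congr fine.
under eq_integral do rewrite /fubini_F/=.
transitivity (\int[m1]_x ((f x)%:E * \int[m2]_y (g y)%:E))%E.
  apply: eq_integral => x _.
  by rewrite -integralZl//; apply: eq_integral => y _; rewrite EFinM.
(* The inner integral is finite, hence a real constant that can be pulled out. *)
have /fineK <- := integrable_fin_num measurableT intg.
by rewrite integralZr.
Qed.

(** Induction on [n], splitting off the first coordinate along [tcons]. Integrability and value are
    proved together because Fubini in the step needs the tail product to be integrable. *)
Lemma integral_prod_tnth (R : realType) n (f : 'I_n -> measurableTypeR R -> R) :
  (forall j, (@lebesgue_measure R).-integrable setT (EFin \o f j)) ->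
  (lebesgue_tuple R n).-integrable setT
    (fun x => (\prod_(j < n) f j (tnth x j))%:E) /\
  \int[lebesgue_tuple R n]_x (\prod_(j < n) f j (tnth x j)) =
    \prod_(j < n) \int[@lebesgue_measure R]_x f j x.
Proof.
elim: n f => [|n IH] f intf.
  under eq_fun do rewrite big_ord0.
  under eq_Rintegral do rewrite big_ord0.
  rewrite big_ord0 Rintegral_cst//= indicE mem_set//= mulr1; split => //.
  exact: (finite_measure_integrable_cst (\d_[tuple] : {finite_measure set (0.-tuple (measurableTypeR R)) -> \bar R}) 1).
have tE (x : measurableTypeR R) (t : n.-tuple (measurableTypeR R)) (j : 'I_n) :
    tnth (tcons (x, t)) (lift ord0 j) = tnth t j by rewrite !(tnth_nth x).
have [inttl Etl] := IH (fun j => f (lift ord0 j)) (fun j => intf _).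
have mprod : measurable_fun setT (fun x : n.+1.-tuple (measurableTypeR R) =>
    (\prod_(j < n.+1) f j (tnth x j))%:E).
  apply/measurable_EFinP/measurable_prod => j _.
  apply: measurableT_comp; last exact: measurable_tnth.
  by apply/measurable_EFinP; exact: (measurable_int (@lebesgue_measure R) (intf j)).
have compE : (fun x : n.+1.-tuple (measurableTypeR R) =>
      (\prod_(j < n.+1) f j (tnth x j))%:E) \o @tcons _ _ n =
    fun p => (f ord0 p.1 * \prod_(j < n) f (lift ord0 j) (tnth p.2 j))%:E.
  apply/funext => -[x t] /=; rewrite big_ord_recl; congr (_ * _)%:E.
  by apply: eq_bigr => j _; rewrite tE.
have intc := integrable_tensor (intf ord0) inttl.
rewrite -compE in intc.
split; first exact: (integrable_pushforward (@measurable_tcons _ _ _) mprod intc).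
rewrite {1}/Rintegral (integral_pushforward (@measurable_tcons _ _ _) mprod intc)//.
rewrite preimage_setT compE.
have := integral_tensor (intf ord0) inttl; rewrite /Rintegral => ->.
by rewrite [X in _ * X]Etl big_ord_recl.
Qed.

(** * Linearity of evaluation and integration, and fooling functions *)

Section fun_space_theory.
Context {d} {T : measurableType d} {R : realType}.
Context {mu : {measure set T -> \bar R}} {D : set T} (F : fun_space mu D).
Implicit Types f g : F.

Lemma fs_eval0 x : fs_eval (0 : F) x = 0.
Proof.
by have := fs_eval_linear (-1) 0 (0 : F) x; rewrite scaler0 addr0 mulN1r addNr.
Qed.

Lemma fs_evalD f g x : fs_eval (f + g) x = fs_eval f x + fs_eval g x.
Proof. by have := fs_eval_linear 1 f g x; rewrite scale1r mul1r. Qed.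

Lemma fs_evalZ (c : R) f x : fs_eval (c *: f) x = c * fs_eval f x.
Proof. by rewrite -[c *: f]addr0 fs_eval_linear fs_eval0 addr0. Qed.

Lemma fs_eval_sum (I : Type) (r : seq I) (P : pred I) (f : I -> F) x :
  fs_eval (\sum_(i <- r | P i) f i) x = \sum_(i <- r | P i) fs_eval (f i) x.
Proof.
exact: (big_morph (fun g : F => fs_eval g x) (fun f g => fs_evalD f g x)
  (fs_eval0 x)).
Qed.

(** Turns integrals over [D] into integrals over the whole space, where the Fubini lemmas are
    stated. *)
Lemma fs_eval_restrict f : fs_eval f \_ D = fs_eval f.
Proof.
apply/funext => x; rewrite patchE; case: ifPn => // /negP xD.
by rewrite fs_eval_out// => Dx; apply: xD; rewrite inE.
Qed.

Hypothesis mD : measurable D.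

Lemma IntD f g : Int (f + g) = Int f + Int g.
Proof.
rewrite /Int; under eq_Rintegral do rewrite fs_evalD.
by rewrite RintegralD//; exact: fs_integrable.
Qed.

Lemma IntZ (c : R) f : Int (c *: f) = c * Int f.
Proof.
rewrite /Int; under eq_Rintegral do rewrite fs_evalZ.
by rewrite RintegralZl//; exact: fs_integrable.
Qed.

Lemma Int_sum (I : Type) (r : seq I) (P : pred I) (f : I -> F) :
  Int (\sum_(i <- r | P i) f i) = \sum_(i <- r | P i) Int (f i).
Proof.
by apply: (big_morph _ IntD); rewrite -(scale0r (0 : F)) IntZ mul0r.
Qed.

(* f is a fooling function: the algorithm cannot tell it from 0. *)
Lemma wc_error_fooling N (a : 'I_N -> R) (x : 'I_N -> T) f (c : R) :
  0 < c -> `|f| <= c -> (forall k, fs_eval f (x k) = 0) ->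
  ((`|Int f| / c)%:E <= @wc_error _ _ _ _ _ F (lin_alg a x))%E.
Proof.
(* Scaling by [c] rather than by the norm of [f] suffices to land in the unit ball. *)
move=> c0 fc fx0; apply: ereal_sup_ubound; exists (c^-1 *: f).
  by rewrite /unit_ball/= normrZ gtr0_norm ?invr_gt0// mulrC ler_pdivrMr ?mul1r.
rewrite /lin_alg big1 => [|k _]; last by rewrite fs_evalZ fx0 !mulr0.
by rewrite subr0 IntZ normrM gtr0_norm ?invr_gt0// mulrC.
Qed.

End fun_space_theory.

(** * Expansion of tensor products and the fooling argument *)

Section tensor_theory.
Context (R : realType) (D1 : set (measurableTypeR R)).
Hypothesis mD1 : measurable D1.
Context (F1 : fun_space (@lebesgue_measure R) D1).

Lemma measurable_box d : measurable (@box R D1 d).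
Proof. exact: (@measurable_tuple_box R d (fun=> D1)). Qed.

Lemma Int_elem d (F : tensor_power F1 d) (f : 'I_d -> F1) :
  Int (elem F f) = \prod_(j < d) Int (f j).
Proof.
have intf j : (@lebesgue_measure R).-integrable setT (EFin \o fs_eval (f j)).
  have := (integrable_mkcond (EFin \o fs_eval (f j)) mD1).1 (fs_integrable (f j)).
  by rewrite restrict_EFin fs_eval_restrict.
have [_ prodE] := integral_prod_tnth R d (fun j => fs_eval (f j)) intf.
rewrite /Int Rintegral_mkcond fs_eval_restrict.
under eq_Rintegral do rewrite elemE.
rewrite prodE; apply: eq_bigr => j _.
by rewrite [in RHS]Rintegral_mkcond fs_eval_restrict.
Qed.

Variables h0 h1 : F1.

(** Multilinearity of [elem] is not a field of the record; this instance follows by expanding the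
    pointwise product and using injectivity of [fs_eval]. *)
Lemma elemD d (F : tensor_power F1 d) :
  elem F (fun=> h0 + h1) = \sum_(u : {set 'I_d}) mixed F h0 h1 u.
Proof.
apply/fs_eval_inj/funext => x; rewrite elemE fs_eval_sum.
under eq_bigr do rewrite fs_evalD.
rewrite bigA_distr; apply: eq_bigr => u _.
by rewrite elemE; apply: eq_bigr => j _; case: ifP.
Qed.

Lemma Int_mixed_le d (F : tensor_power F1 d) (u : {set 'I_d}) :
  0 <= Int h0 -> 0 <= Int h1 ->
  Int (mixed F h0 h1 u) <= Num.max (Int h0) (Int h1) ^+ d.
Proof.
move=> h0_ge0 h1_ge0; rewrite Int_elem -[d in X in _ <= X]card_ord -prodr_const.
by apply: ler_prod => j _; case: ifP => _; rewrite ?h0_ge0 ?h1_ge0 le_max lexx ?orbT.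
Qed.

Hypothesis disj : forall x, fs_eval h0 x = 0 \/ fs_eval h1 x = 0.

(** If the product is nonzero at [x], so is each factor; by [disj], [u] must then consist exactly of
    the coordinates where [h0] is nonzero. *)
Lemma mixed_eq0 d (F : tensor_power F1 d) (u : {set 'I_d}) x :
  u != [set j | fs_eval h0 (tnth x j) != 0]%SET -> fs_eval (mixed F h0 h1 u) x = 0.
Proof.
apply: contra_neqP => /eqP; rewrite elemE => /prodf_neq0 ux.
apply/setP => j; rewrite inE; have := ux j isT; case: ifP => _ //.
by case: (disj (tnth x j)) => ->; rewrite eqxx.
Qed.

(** [c] need only dominate the norms of all partial sums of the expansion; under (D4) the norm of
    [h_d] does. *)
Lemma min_error_ge (N d : nat) (F : tensor_power F1 d) (c : R) :
  0 <= Int h0 -> 0 <= Int h1 -> 0 < c ->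
  (forall U : {set {set 'I_d}}, `|\sum_(u in U) mixed F h0 h1 u| <= c) ->
  ((Num.max ((Int h0 + Int h1) ^+ d -
      N%:R * Num.max (Int h0) (Int h1) ^+ d) 0 / c)%:E <= min_error F N)%E.
Proof.
move=> h0_ge0 h1_ge0 c0 Uc; apply: le_ereal_inf_tmp => _ [a [x [_ ->]]].
(* The only products that can be nonzero at some node; as an image of ['I_N], [V] has at most [N]
   elements. *)
pose V := ([set [set j | fs_eval h0 (tnth (x k) j) != 0] | k : 'I_N])%SET.
pose f : F := \sum_(u in ~: V) mixed F h0 h1 u.
have fx0 k : fs_eval f (x k) = 0.
  rewrite fs_eval_sum big1// => u; rewrite inE => uV; apply: mixed_eq0.
  by apply: contraNneq uV => ->; exact: imset_f.
apply: le_trans (wc_error_fooling _ (measurable_box d) N a x f c c0 (Uc _) fx0).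
(* The positive part comes for free, since [|Int f|] is nonnegative. *)
rewrite lee_fin ler_pM2r ?invr_gt0// ge_max normr_ge0 andbT.
apply: le_trans (ler_norm _).
have IntE : (Int h0 + Int h1) ^+ d = \sum_(u in V) Int (mixed F h0 h1 u) + Int f.
  rewrite -(IntD _ mD1) -[d in LHS]card_ord -prodr_const -(Int_elem d F) elemD.
  rewrite !(Int_sum _ (measurable_box d)) (bigID (mem V))/=; congr (_ + _).
  by apply: eq_bigl => u; rewrite inE.
rewrite IntE lerBlDr addrC lerD2l.
apply: le_trans (_ : \sum_(u in V) Num.max (Int h0) (Int h1) ^+ d <= _).
  by apply: ler_sum => u _; exact: Int_mixed_le.
rewrite sumr_const -[leLHS]mulr_natl ler_wpM2r ?exprn_ge0 ?le_max ?h0_ge0// ler_nat.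
by apply: leq_trans (leq_imset_card _ _) _; rewrite card_ord.
Qed.

End tensor_theory.

(** * Error bound, information complexity and curse of dimensionality *)

Theorem theorem1 (R : realType) (D1 : set (measurableTypeR R))
  (mD1 : measurable D1)
  (F1 : fun_space (@lebesgue_measure R) D1)
  (F : forall d : nat, tensor_power F1 d)
  (h : F1)
  (h_worst : worst_case h)
  (hd_worst : forall d : nat, (0 < d)%N ->
     worst_case (elem (F d) (fun=> h)))
  (h0 h1 : F1)
  (h_dec : h = h0 + h1)
  (a : R)
  (D0_nonempty : [set x : R | D1 x /\ x <= a] !=set0)
  (D1_nonempty : [set x : R | D1 x /\ a <= x] !=set0)
  (h0_supp : [set x : R | fs_eval h0 x != 0] `<=` [set x : R | D1 x /\ x <= a])
  (h1_supp : [set x : R | fs_eval h1 x != 0] `<=` [set x : R | D1 x /\ a <= x])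
  (disj : fs_eval h0 a = 0 \/ fs_eval h1 a = 0)
  (h0_pos : 0 < Int h0)
  (h1_pos : 0 < Int h1)
  (D4 : forall d : nat, (0 < d)%N -> forall U : {set {set 'I_d}},
     `|\sum_(u in U) mixed (F d) h0 h1 u|
       <= `|\sum_(u : {set 'I_d}) mixed (F d) h0 h1 u|) :
  let alpha := Num.max (Int h0) (Int h1) / (Int h0 + Int h1) in
  (2^-1 <= alpha < 1) /\
  (forall N d : nat, (0 < d)%N ->
     ((Num.max (1 - N%:R * alpha ^+ d) 0)%:E * init_error (F d)
        <= min_error (F d) N)%E) /\
  (forall (eps : R) (d : nat), 0 < eps < 1 -> (0 < d)%N ->
     (((1 / alpha) ^+ d * (1 - eps))%:E <= info_complexity (F d) eps)%E) /\
  curse F.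
Proof.
have h0_ge0 := ltW h0_pos; have h1_ge0 := ltW h1_pos.
set I0 := Int h0; set I1 := Int h1; set alpha := _ / _.
have S_gt0 : 0 < I0 + I1 by exact: addr_gt0.
have M_gt0 : 0 < Num.max I0 I1 by rewrite lt_max h0_pos.
have alpha_gt0 : 0 < alpha by exact: divr_gt0.
have alpha_lt1 : alpha < 1.
  rewrite ltr_pdivrMr// mul1r gt_max.
  by rewrite ltrDl ltrDr h0_pos h1_pos.
have alpha_ge : 2^-1 <= alpha.
  rewrite ler_pdivlMr// mulrC ler_pdivrMr// mulr_natr mulr2n.
  by rewrite lerD// le_max lexx ?orbT.
(* Two nonzero values at [x] would force [x = a], the point settled by [disj]. *)
have supp x : fs_eval h0 x = 0 \/ fs_eval h1 x = 0.
  have [->|h0x] := eqVneq (fs_eval h0 x) 0; first by left.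
  have [->|h1x] := eqVneq (fs_eval h1 x) 0; first by right.
  have [[_ xa] [_ ax]] := (h0_supp x h0x, h1_supp x h1x).
  by have -> : x = a by apply/eqP; rewrite eq_le xa ax.
have Int_hd d : Int (elem (F d) (fun=> h)) = (I0 + I1) ^+ d.
  by rewrite (Int_elem _ _ mD1) prodr_const card_ord h_dec (IntD _ mD1).
(* A zero [h_d] would have integral 0, not [(I0 + I1) ^+ d]. *)
have hd_gt0 d : 0 < `|elem (F d) (fun=> h)|.
  rewrite normr_gt0; apply: contraTneq (exprn_gt0 d S_gt0) => hd0.
  rewrite -Int_hd hd0 -(scale0r (0 : F d)).
  by rewrite (IntZ _ (measurable_box _ _ mD1 _)) mul0r ltxx.
have e0E d : (0 < d)%N ->
    init_error (F d) = ((I0 + I1) ^+ d / `|elem (F d) (fun=> h)|)%:E.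
  move=> d_gt0; rewrite (hd_worst d d_gt0).
  by rewrite (IntZ _ (measurable_box _ _ mD1 _)) Int_hd mulrC.
have e0_gt0 d : 0 < (I0 + I1) ^+ d / `|elem (F d) (fun=> h)|.
  by rewrite divr_gt0// exprn_gt0.
have eN_ge N d : (0 < d)%N ->
    ((Num.max (1 - N%:R * alpha ^+ d) 0)%:E * init_error (F d)
      <= min_error (F d) N)%E.
  move=> d_gt0; rewrite e0E// -EFinM mulrA maxr_pMl ?exprn_ge0 ?(ltW S_gt0)//.
  (* Here [alpha * (I0 + I1)] collapses to [Num.max I0 I1]. *)
  rewrite mul0r mulrBl mul1r -mulrA -exprMn divfK ?gt_eqF//.
  apply: min_error_ge => // U.
  by rewrite h_dec elemD; exact: D4.
have info_ge eps d : 0 < eps < 1 -> (0 < d)%N ->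
    (((1 / alpha) ^+ d * (1 - eps))%:E <= info_complexity (F d) eps)%E.
  (* Bounding each admissible [N] also covers the case where none exists and the infimum is
     [+oo]. *)
  move=> _ d_gt0; apply: le_ereal_inf_tmp => _ [N [_ Neps] <-].
  have := le_trans (eN_ge N d d_gt0) Neps.
  rewrite e0E// -!EFinM !lee_fin ler_pM2r// ge_max => /andP[le_eps _].
  rewrite div1r exprVn mulrC ler_pdivrMr ?exprn_gt0//.
  by rewrite lerBlDr addrC -lerBlDr.
split; first by rewrite alpha_ge.
split=> //; split=> //.
(* With threshold 1/2, the factor [1 - eps] is the constant and [1 / alpha] the base. *)
exists 2^-1; split; first by rewrite invr_gt0.
exists (1 - 2^-1), (1 / alpha); split; last split.
- by rewrite subr_gt0 invf_lt1// ltr1n.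
- by rewrite div1r invf_gt1.
- move=> d d_gt0; rewrite mulrC; apply: info_ge => //.
  by rewrite invr_gt0 ltr0n invf_lt1// ltr1n.
Qed.
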